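(* Let $X$ be a smooth complete toric variety with fan $\Sigma$ and Cox ring $R=\mathbb{C}[x_1,\dots,x_r]$. Let $I,J\subset R$ be two monomial ideals with Klyachko diagrams $\{(\mathcal{C}^\sigma_I,\Delta^\sigma_I)\}_{\sigma\in\Sigma}$ and $\{(\mathcal{C}^\sigma_J,\Delta^\sigma_J)\}_{\sigma\in\Sigma}$, and let $s^I_\rho$, $s^J_\rho$ denote the corresponding minimal exponents for $\rho\in\Sigma(1)$. Then the Klyachko diagram of $I+J$ is given, for each $\sigma\in\Sigma$, by $$\mathcal{C}^\sigma_{I+J}=\{m\in M\mid\langle m,\rho\rangle\ge\min\{s^I_\rho,s^J_\rho\}\text{ for all }\rho\in\sigma(1)\},$$ $$\Delta^\sigma_{I+J}=(\Delta^\sigma_I\cap\Delta^\sigma_J)\cup\big(\Delta^\sigma_I\cap(\mathcal{C}^\sigma_{I+J}\setminus\mathcal{C}^\sigma_J)\big)\cup\big(\Delta^\sigma_J\cap(\mathcal{C}^\sigma_{I+J}\setminus\mathcal{C}^\sigma_I)\big)\cup\big(\mathcal{C}^\sigma_{I+J}\setminus(\mathcal{C}^\sigma_I\cup\mathcal{C}^\sigma_J)\big).$$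
   Context: Setting. $X$ is an $n$-dimensional smooth complete toric variety over $\mathbb{C}$ with fan $\Sigma\subset N\otimes\mathbb{R}$, $N\cong\mathbb{Z}^n$, $M=\mathrm{Hom}(N,\mathbb{Z})$. $\Sigma(1)=\{\rho_1,\dots,\rho_r\}$ is the ordered set of rays, $\sigma(1)$ the set of rays of a cone $\sigma$, $n(\rho)\in N$ is the first nonzero lattice point on $\rho$, and $\langle m,\rho\rangle:=\langle m,n(\rho)\rangle$. The Cox ring $R=\mathbb{C}[x_1,\dots,x_r]$ has one variable $x_i=x_{\rho_i}$ per ray. Klyachko diagram. Let $I=(m_1,\dots,m_t)$, $t\ge1$, be an ideal generated by monomials $m_i$; $\deg_{\rho_j}$ of a monomial is its exponent in $x_j$. Put $s_j=s_{\rho_j}=s^I_{\rho_j}:=\min_i\deg_{\rho_j}(m_i)$. For $\sigma=\mathrm{cone}(\rho_{i_1},\dots,\rho_{i_c})$ of dimension $c$, put $\mathcal{C}^\sigma_I:=\{m\in M\mid\langle m,\rho_{i_p}\rangle\ge s_{i_p},\ 1\le p\le c\}$. For a subset $\mathcal{S}=\{n_1,\dots,n_s\}\subset\{m_1,\dots,m_t\}$ define $\Delta^\sigma_I(\mathcal{S})\subset\mathcal{C}^\sigma_I$ recursively: - $\Delta^\sigma_I(\emptyset):=\mathcal{C}^\sigma_I$. - If $s\ge1$ and $c=0$ (i.e. $\sigma=\{0\}$): $\Delta^\sigma_I(\mathcal{S}):=\emptyset$. - If $s\ge1$ and $c\geq 1$, order the elements so that $\deg_{\rho_{i_c}}(n_{1})\le\cdots\le\deg_{\rho_{i_c}}(n_{s})$.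 If $c=1$: $\Delta^\sigma_I(\mathcal{S}):=\{m\mid s_{i_1}\le\langle m,\rho_{i_1}\rangle<\deg_{\rho_{i_1}}(n_1)\}$. If $c\ge2$, put $\sigma'=\mathrm{cone}(\rho_{i_1},\dots,\rho_{i_{c-1}})$ and $\Delta^\sigma_I(\mathcal{S}):=\bigcup_{j=0}^s\Delta^\sigma_I(\mathcal{S})_j$, where $\Delta^\sigma_I(\mathcal{S})_0:=\{m\mid s_{i_c}\le\langle m,\rho_{i_c}\rangle<\deg_{\rho_{i_c}}(n_1)\}\cap\Delta^{\sigma'}_I(\emptyset)$, $\Delta^\sigma_I(\mathcal{S})_j:=\{m\mid\deg_{\rho_{i_c}}(n_j)\le\langle m,\rho_{i_c}\rangle<\deg_{\rho_{i_c}}(n_{j+1})\}\cap\Delta^{\sigma'}_I(\{n_1,\dots,n_j\})$ for $1\le j\le s-1$, $\Delta^\sigma_I(\mathcal{S})_s:=\{m\mid\deg_{\rho_{i_c}}(n_s)\le\langle m,\rho_{i_c}\rangle\}\cap\Delta^{\sigma'}_I(\{n_1,\dots,n_s\})$. Finally $\Delta^\sigma_I:=\Delta^\sigma_I(\{m_1,\dots,m_t\})$. The collection $\{(\mathcal{C}^\sigma_I,\Delta^\sigma_I)\}_{\sigma\in\Sigma}$ is the Klyachko diagram of $I$. *)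

(* Defs.v *)
From HB Require Import structures.
From mathcomp Require Import all_boot all_order all_algebra.
From mathcomp Require Import boolp classical_sets functions cardinality reals.
From mathcomp Require Import complex.
From mathcomp Require Import mpoly.

Set Implicit Arguments.
Unset Strict Implicit.
Unset Printing Implicit Defensive.

Import Order.TTheory GRing.Theory Num.Theory.
Local Open Scope classical_set_scope.
Local Open Scope ring_scope.

(* N = Z^n and M = Hom(N, Z). *)
Notation latN n := 'rV[int]_n.
Notation latM n := {additive 'rV[int]_n -> int}.

Section Fans.
Variables (R : realType) (n : nat).
Implicit Types (s t : set 'rV[R]_n) (Sigma : set (set 'rV[R]_n)).

Definition to_real (u : latN n) : 'rV[R]_n := map_mx (fun z : int => z%:~R) u.

Definition generated_cone (k : nat) (u : 'I_k -> latN n) : set 'rV[R]_n :=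
  [set v | exists a : 'I_k -> R,
     (forall i, 0 <= a i) /\ v = \sum_(i < k) a i *: to_real (u i)].

Definition rational_polyhedral s : Prop :=
  exists (k : nat) (u : 'I_k -> latN n), s = generated_cone u.

Definition strongly_convex s : Prop :=
  forall v, s v -> s (- v) -> v = 0.

(* t is cut out of s by a linear form u that is nonnegative on s. *)
Definition face_of t s : Prop :=
  exists u : 'cV[R]_n,
    (forall v, s v -> 0 <= (v *m u) 0 0) /\
    t = [set v | s v /\ (v *m u) 0 0 = 0].

(* The linear span of s has dimension d: it has a basis, the rows of A,
   consisting of elements of s. *)
Definition cone_dim s (d : nat) : Prop :=
  exists A : 'M[R]_(d, n),
    [/\ row_free A, forall i, s (row i A) & forall v, s v -> (v <= A)%MS].

Definition is_fan Sigma : Prop :=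
  [/\ finite_set Sigma,
      forall s, Sigma s -> rational_polyhedral s /\ strongly_convex s,
      forall s t, Sigma s -> face_of t s -> Sigma t &
      forall s t, Sigma s -> Sigma t ->
        face_of (s `&` t) s /\ face_of (s `&` t) t].

Definition fan_rays Sigma : set (set 'rV[R]_n) :=
  [set rho | Sigma rho /\ cone_dim rho 1].

Definition first_lattice_point (rho : set 'rV[R]_n) (u : latN n) : Prop :=
  [/\ u != 0, rho (to_real u) &
      forall w : latN n, w != 0 -> rho (to_real w) ->
        exists2 a : R, 1 <= a & to_real w = a *: to_real u].

(* n(rho); the default value 0 is never taken on a rational ray. *)
Definition ray_gen (rho : set 'rV[R]_n) : latN n :=
  xget 0 [set u | first_lattice_point rho u].

Definition pairing (m : latM n) (rho : set 'rV[R]_n) : int := m (ray_gen rho).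

(* The ray generators of s are part of a Z-basis of N (the rows of B). *)
Definition smooth_cone s : Prop :=
  exists2 B : 'M[int]_n, B \in unitmx &
    forall rho, face_of rho s -> cone_dim rho 1 ->
      exists i, ray_gen rho = row i B.

(* A toric variety is smooth, resp. complete, exactly when its fan is. *)
Definition smooth_fan Sigma : Prop := forall s, Sigma s -> smooth_cone s.

Definition complete_fan Sigma : Prop :=
  forall v : 'rV[R]_n, exists2 s, Sigma s & s v.

Definition ordered_rays Sigma (r : nat) (rho : 'I_r -> set 'rV[R]_n) : Prop :=
  injective rho /\ range rho = fan_rays Sigma.

Definition lists_rays_of (r : nat) (rho : 'I_r -> set 'rV[R]_n) s
    (idx : seq 'I_r) : Prop :=
  uniq idx /\ forall i, i \in idx <-> face_of (rho i) s.

End Fans.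

Section MonomialIdeals.
Variables (R : realType) (r : nat).

Definition Cox : Type := {mpoly R[i][r]}.

Definition ideal_gen (g : seq 'X_{1..r}) : set Cox :=
  [set f | exists h : 'I_(size g) -> {mpoly R[i][r]},
     f = \sum_(k < size g) h k * 'X_[nth 0%MM g k]].

Definition generated_by_monomials (I : set Cox) (g : seq 'X_{1..r}) : Prop :=
  g != [::] /\ I = ideal_gen g.

Definition ideal_add (I J : set Cox) : set Cox :=
  [set f | exists a b : {mpoly R[i][r]}, [/\ I a, J b & f = a + b]].

End MonomialIdeals.

(* The least exponent of the j-th variable in the (nonempty) list g. *)
Definition min_exp (r : nat) (g : seq 'X_{1..r}) (j : 'I_r) : nat :=
  \big[minn/head 0%MM g j]_(m <- g) m j.

Section KlyachkoDiagram.
Variables (R : realType) (n r : nat) (rho : 'I_r -> set 'rV[R]_n).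
Variable g : seq 'X_{1..r}.
Implicit Types (idx : seq 'I_r) (S : seq 'X_{1..r}).

Definition Klyachko_C idx : set (latM n) :=
  [set m | forall i, i \in idx -> (min_exp g i)%:Z <= pairing m (rho i)].

(* The cone is given by the reversed list [:: i_c; ...; i_1] of its ray indices,
   since the recursion removes the last ray.  With ms the sorted list
   n_1, ..., n_s, the element n_j is nth 0%MM ms j.-1. *)
Fixpoint Delta_rev idx S : set (latM n) :=
  if S is [::] then Klyachko_C idx else
  match idx with
  | [::] => set0
  | i :: idx' =>
    let ms := sort (fun a b : 'X_{1..r} => (a i <= b i)%N) S in
    let s := size S in
    let deg j : int := (nth 0%MM ms j.-1 i)%:Z in
    let low : set (latM n) :=
      [set m | (min_exp g i)%:Z <= pairing m (rho i) < deg 1%N] in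
    if idx' is [::] then low else
    (low `&` Delta_rev idx' [::])
    `|` (\bigcup_(j in [set j | (1 <= j <= s.-1)%N])
          ([set m | deg j <= pairing m (rho i) < deg j.+1]
           `&` Delta_rev idx' (take j ms)))
    `|` ([set m | deg s <= pairing m (rho i)] `&` Delta_rev idx' ms)
  end.

Definition Klyachko_Delta idx : set (latM n) := Delta_rev (rev idx) g.

End KlyachkoDiagram.

(* Main.v *)
Require Import Defs.
From HB Require Import structures.
From mathcomp Require Import all_boot all_order all_algebra.
From mathcomp Require Import boolp classical_sets functions cardinality reals.
From mathcomp Require Import complex.
From mathcomp Require Import mpoly.

Set Implicit Arguments.
Unset Strict Implicit.
Unset Printing Implicit Defensive.

Import Order.TTheory GRing.Theory Num.Theory.
Local Open Scope classical_set_scope.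
Local Open Scope ring_scope.

(** The recursive definition of Delta unfolds to a description that no longer
    sees the recursion or the ordering of the rays.  Write chi^m for the
    Laurent monomial whose exponent in the variable of each ray rho is
    <m, rho>.  Once the variables of the rays outside sigma are inverted,
    a monomial x divides chi^m exactly when x_i <= <m, rho_i> for every ray
    rho_i of sigma.  Then Delta_I^sigma consists of the points m of C_I^sigma
    such that no generator of I divides chi^m over sigma
    ([Klyachko_DeltaE]).  The recursion computes this by slicing: for the last
    ray rho_i, the generators with x_i > <m, rho_i> cannot divide chi^m and are
    discarded, and those that remain are an initial segment of the generators
    sorted by x_i, to be tested on the face spanned by the other rays
    ([Delta_rev_cons]).

    For a sum of ideals, the given generators of I + J and the concatenation of
    those of I and J generate the same ideal, so that each list is divisible,
    entry by entry, by elements of the other ([ideal_add_gens_div]).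
    Divisibility preserves both bounds on the least exponents and the absence
    of a generator dividing chi^m.  Hence C_{I+J} is given by the minima of the
    exponents, and m lies in Delta_{I+J} exactly when m lies in C_{I+J} and no
    generator of I and none of J divides chi^m.  Outside C_I the condition on I
    holds by itself ([avoids_out_C]), because some exponent of chi^m is below
    all those of the generators; likewise for J.  The four terms of the formula
    are the four cases for the membership of m in C_I and in C_J. *)

(** * Generators of a sum of monomial ideals *)

Section MonomialGenerators.
Variables (R : realType) (r : nat).
Implicit Types (g : seq 'X_{1..r}) (x : 'X_{1..r}).

Lemma mem_ideal_gen g x : x \in g -> @ideal_gen R r g 'X_[x].
Proof.
move=> gx; have lt_xg : (index x g < size g)%N by rewrite index_mem.
exists (fun k => (k == Ordinal lt_xg)%:R).
rewrite (bigD1 (Ordinal lt_xg)) //= eqxx mul1r nth_index // big1 ?addr0 //.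
by move=> k /negPf->; rewrite mul0r.
Qed.

(** Every monomial of a multiple of y is divisible by y, and the monomials of a
    sum are among those of its terms. *)
Lemma msupp_ideal_gen g (f : {mpoly R[i][r]}) x :
  @ideal_gen R r g f -> x \in msupp f -> exists2 y, y \in g & (y <= x)%MM.
Proof.
case=> h -> /msupp_sum_le/flattenP[_ /mapP[k _ ->]].
rewrite (perm_mem (msuppMX _ _)) => /mapP[y _ ->].
by exists (nth 0%MM g k); [exact: mem_nth | exact: lem_addr].
Qed.

Lemma ideal_addl (I J : set (Cox R r)) g : J = @ideal_gen R r g ->
  I `<=` ideal_add I J.
Proof.
move=> -> f If; exists f, 0; split=> //; last by rewrite addr0.
by exists (fun=> 0); rewrite big1 // => k _; rewrite mul0r.
Qed.

Lemma ideal_addC (I J : set (Cox R r)) : ideal_add I J = ideal_add J I.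
Proof.
by apply/seteqP; split=> f [a [b [Ia Jb ->]]]; exists b, a; rewrite addrC.
Qed.

(** Monomial generators are not unique, but any two lists of them for the same
    ideal divide each other; this is all that the Klyachko diagram sees. *)
Lemma ideal_add_gens_div (I J : set (Cox R r)) (gI gJ gK : seq 'X_{1..r}) :
  I = @ideal_gen R r gI -> J = @ideal_gen R r gJ -> ideal_add I J = @ideal_gen R r gK ->
  (forall x, x \in gK -> exists2 y, y \in gI ++ gJ & (y <= x)%MM) /\
  (forall x, x \in gI ++ gJ -> exists2 y, y \in gK & (y <= x)%MM).
Proof.
move=> hI hJ hK; split=> x gx.
  have : ideal_add I J 'X_[x] by rewrite hK; apply: mem_ideal_gen.
  case=> a [b [Ia Jb xE]].
  have : x \in msupp (a + b) by rewrite -xE msuppX mem_head.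
  move=> /msuppD_le; rewrite mem_cat => /orP[ax|bx].
    rewrite hI in Ia; have [y gy le_yx] := msupp_ideal_gen Ia ax.
    by exists y => //; rewrite mem_cat gy.
  rewrite hJ in Jb; have [y gy le_yx] := msupp_ideal_gen Jb bx.
  by exists y => //; rewrite mem_cat gy orbT.
have Kx : @ideal_gen R r gK 'X_[x].
  move: gx; rewrite -hK mem_cat => /orP[gx|gx].
    by apply: (ideal_addl hJ); rewrite hI; apply: mem_ideal_gen.
  by rewrite ideal_addC; apply: (ideal_addl hI); rewrite hJ; apply: mem_ideal_gen.
by apply: msupp_ideal_gen Kx _; rewrite msuppX mem_head.
Qed.

(** Since the least exponent is attained, an upper bound on it is a statement
    about a single generator, and can be transported along divisibility. *)
Lemma min_exp_le g (i : 'I_r) (z : int) : g != [::] ->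
  (min_exp g i)%:Z <= z <-> exists2 x, x \in g & (x i)%:Z <= z.
Proof.
move=> g0; rewrite /min_exp; split.
  have: exists2 x, x \in g & \big[minn/head 0%MM g i]_(m <- g) m i = x i.
    have hg : head 0%MM g \in g by case: (g) g0 => //= a s _; exact: mem_head.
    rewrite big_seq; apply: (big_ind (fun k => exists2 x, x \in g & k = x i))
      => [|a b [x gx ->] [y gy ->]|x gx].
    - by exists (head 0%MM g).
    - by case: (leqP (x i) (y i)) => _; [exists x | exists y].
    - by exists x.
  by case=> x gx ->; exists x.
case=> x gx; apply: le_trans; rewrite lez_nat {g0}.
set d := (X in \big[_/X]_(_ <- _) _); move: d => d.
elim: g gx => //= a s IHs; rewrite big_cons inE geq_min.
by case/predU1P=> [->|/IHs ->]; rewrite ?leqnn ?orbT.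
Qed.

Lemma min_exp_le_mem g (i : 'I_r) x : x \in g -> (min_exp g i <= x i)%N.
Proof.
move=> gx; rewrite -lez_nat; apply/min_exp_le; first by case: g gx.
by exists x.
Qed.

End MonomialGenerators.

(** * Sublevel sets of a sorted list *)

Section Sublevel.
Variables (T : Type) (F : T -> nat) (x0 : T) (z : int).
Let sub s := [seq x <- s | ((F x)%:Z <= z)].

Lemma filter_sublevel_nil x s :
  path (fun a b => F a <= F b)%N x s -> z < (F x)%:Z -> sub s = [::].
Proof.
elim: s x => //= y s IHs x /andP[le_xy pys] lt_zx.
have lt_zy : z < (F y)%:Z by apply: lt_le_trans lt_zx _; rewrite lez_nat.
by rewrite leNgt lt_zy /= (IHs y).
Qed.

(** The recursion for Delta passes a prefix of the sorted generators to the
    smaller cone; the prefix is the sublevel set of the exponent. *)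
Lemma sorted_sublevel_take s : sorted (fun a b => F a <= F b)%N s ->
  sub s = take (size (sub s)) s.
Proof.
elim: s => //= x s IHs pxs; case: (lerP (F x)%:Z z) => /= [_|lt_zx].
  by rewrite {1}IHs // (path_sorted pxs).
by rewrite (filter_sublevel_nil pxs lt_zx).
Qed.

(** Turns a comparison of the threshold with the k-th value into a comparison of
    k with the size of the sublevel set.  The slices of Delta are given by such
    comparisons, so that each of them fixes the length of the prefix. *)
Lemma sorted_sublevel_nth s k : sorted (fun a b => F a <= F b)%N s ->
  (k < size s)%N -> ((F (nth x0 s k))%:Z <= z) = (k < size (sub s))%N.
Proof.
elim: s k => //= x s IHs k pxs lt_k; case: (lerP (F x)%:Z z) => /= [le_xz|lt_zx].
  by case: k lt_k => [//|k] lt_k /=; rewrite IHs // (path_sorted pxs).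
rewrite (filter_sublevel_nil pxs lt_zx) ltn0.
case: k lt_k => [_|k lt_k] /=; first by rewrite leNgt lt_zx.
by rewrite IHs ?(path_sorted pxs) // (filter_sublevel_nil pxs lt_zx) ltn0.
Qed.

End Sublevel.

(** * Delta as a set of points missed by the generators *)

Section DeltaStaircase.
Variables (R : realType) (n r : nat) (rho : 'I_r -> set 'rV[R]_n).
Implicit Types (idx : seq 'I_r) (g S : seq 'X_{1..r}) (m : latM n).

(** No monomial of S divides the character chi^m after the variables of the rays
    outside idx have been inverted: the ideal generated by S, localized at the
    cone, vanishes in degree m. *)
Definition avoids idx S m : Prop :=
  forall x, x \in S -> exists2 i, i \in idx & pairing m (rho i) < (x i)%:Z.

Lemma avoids_cons i idx S m :
  avoids (i :: idx) S m <->
  avoids idx [seq x : 'X_{1..r} <- S | (x i)%:Z <= pairing m (rho i)] m.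
Proof.
split=> av x.
  rewrite mem_filter => /andP[le_xm /av[j]]; rewrite inE => /predU1P[->|].
    by rewrite ltNge le_xm.
  by exists j.
move=> Sx; case: (lerP (x i)%:Z (pairing m (rho i))) => [le_xm|lt_mx].
  have [|j jidx lt_mx] := av x; first by rewrite mem_filter le_xm.
  by exists j => //; rewrite inE jidx orbT.
by exists i; rewrite ?mem_head.
Qed.

Lemma Klyachko_C_cons g i idx m :
  Klyachko_C rho g (i :: idx) m <->
  (min_exp g i)%:Z <= pairing m (rho i) /\ Klyachko_C rho g idx m.
Proof.
split=> [C|[Ci C] j].
  by split=> [|j jidx]; apply: C; rewrite inE ?eqxx ?jidx ?orbT.
by rewrite inE => /predU1P[->|/C].
Qed.

(** The slices of Delta along the first ray i partition the values of
    z = <m, rho_i> at or above the least exponent, according to the number of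
    generators with exponent at most z.  The slice that contains m therefore
    passes to the smaller cone exactly these generators.  The special clause
    for a single ray agrees with this, as over the empty list of rays Delta is
    everything for the empty set of generators and empty otherwise.  The
    inclusion of S in g ensures that the upper slices, which do not mention
    the least exponent, respect it. *)
Lemma Delta_rev_cons g i idx S m : {subset S <= g} -> S != [::] ->
  Delta_rev rho g (i :: idx) S m <->
  (min_exp g i)%:Z <= pairing m (rho i) /\
  Delta_rev rho g idx [seq x : 'X_{1..r} <- sort (fun a b : 'X_{1..r} => a i <= b i)%N S
                       | (x i)%:Z <= pairing m (rho i)] m.
Proof.
move=> sub_Sg S0; set z := pairing m (rho i).
set ms := sort _ S; set f := filter _ ms.
have szms : size ms = size S by rewrite size_sort.
have sort_ms : sorted (fun a b : 'X_{1..r} => a i <= b i)%N ms.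
  by apply: sort_sorted => a b; apply: leq_total.
have nthE := @sorted_sublevel_nth _ (fun x : 'X_{1..r} => x i) 0%MM z ms.
have takeE : f = take (size f) ms by apply: sorted_sublevel_take.
have S_gt0 : (0 < size S)%N by case: (S) S0.
have le_f : (size f <= size S)%N by rewrite -szms size_filter count_size.
have f_eq_ms : size f = size S -> f = ms.
  by move=> fE; rewrite takeE fE -szms take_size.
have min_f : (0 < size f)%N -> (min_exp g i)%:Z <= z.
  case fE: f => [//|x f'] _; have: x \in f by rewrite fE mem_head.
  rewrite mem_filter mem_sort => /andP[le_xz /sub_Sg gx].
  by apply: le_trans le_xz; rewrite lez_nat min_exp_le_mem.
have lowE : (z < (nth 0%MM ms 0 i)%:Z) = (size f == 0%N).
  by rewrite ltNge nthE ?szms // lt0n negbK.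
have topE : ((nth 0%MM ms (size S).-1 i)%:Z <= z) = (size f == size S).
  by rewrite nthE ?szms ?prednK // -?/f eqn_leq le_f.
(* A single ray: only the lowest slice, where no generator remains. *)
case: idx => [|i' idx].
  have -> : Delta_rev rho g [:: i] S m =
            ((min_exp g i)%:Z <= z < (nth 0%MM ms 0 i)%:Z) :> Prop.
    by rewrite /ms; case: (S) S0.
  rewrite lowE; case: (f) => [|x f'] /=; last first.
    by rewrite andbF; split=> // -[].
  by rewrite andbT; split=> [mz|[]//]; split=> // j.
(* Several rays: the slice j is the one with j generators at or below z. *)
set idx' := i' :: idx.
have -> : Delta_rev rho g (i :: idx') S m =
   (([set m | (min_exp g i)%:Z <= pairing m (rho i) < (nth 0%MM ms 0 i)%:Z]
       `&` Delta_rev rho g idx' [::])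
    `|` (\bigcup_(j in [set j | (1 <= j <= (size S).-1)%N])
          ([set m | (nth 0%MM ms j.-1 i)%:Z <= pairing m (rho i)
                    < (nth 0%MM ms j i)%:Z]
           `&` Delta_rev rho g idx' (take j ms)))
    `|` ([set m | (nth 0%MM ms (size S).-1 i)%:Z <= pairing m (rho i)]
           `&` Delta_rev rho g idx' ms)) m.
  by rewrite /ms; case: (S) S0.
split.
  case=> [[[/=]|[j /= /andP[j_gt0 j_lt] [/=]]]|[/=]]; rewrite -/z.
  - by rewrite lowE => /andP[-> /eqP/size0nil ->].
  - have lt_jS : (j < size S)%N by rewrite -(prednK S_gt0) ltnS.
    have lt_j1S : (j.-1 < size S)%N by apply: leq_ltn_trans (leq_pred _) lt_jS.
    rewrite ltNge !nthE ?szms // prednK // -leqNgt -/f -eqn_leq => /eqP jE.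
    by rewrite jE -takeE; split=> //; rewrite min_f -?jE.
  - rewrite topE => /eqP fE; rewrite -(f_eq_ms fE).
    by split=> //; rewrite min_f ?fE.
case=> le_z Df; have [f0|f_gt0] := posnP (size f).
  left; left; split; first by rewrite /= le_z lowE f0 eqxx.
  by rewrite -(size0nil f0).
have [fE|f_lt] := eqVneq (size f) (size S).
  right; split; first by rewrite /= topE fE.
  by rewrite -(f_eq_ms fE).
have {f_lt} f_lt : (size f < size S)%N by rewrite ltn_neqAle f_lt.
left; right; exists (size f).
  by rewrite /= f_gt0 -ltnS prednK.
split; last by rewrite -takeE.
have lt_j1S : ((size f).-1 < size S)%N.
  by apply: leq_ltn_trans (leq_pred _) f_lt.
by rewrite /= -/z ltNge !nthE ?szms // -/f ltnn prednK // leqnn.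
Qed.

(** The generators discarded along the first ray are those that cannot divide
    chi^m because of that ray; the others must fail on a later one. *)
Lemma Delta_revE g idx S m : {subset S <= g} ->
  Delta_rev rho g idx S m <-> Klyachko_C rho g idx m /\ avoids idx S m.
Proof.
elim: idx S => [|i idx IHidx] S sub_Sg; have [->|S0] := eqVneq S [::].
- by split=> [|[]].
- case: S S0 {sub_Sg} => // x S _; split=> // -[_ /(_ x (mem_head _ _))].
  by case.
- by split=> [|[]].
rewrite Delta_rev_cons // IHidx; last first.
  by move=> x; rewrite mem_filter mem_sort => /andP[_ /sub_Sg].
rewrite Klyachko_C_cons avoids_cons.
have av_sort : avoids idx [seq x : 'X_{1..r} <- sort (fun a b : 'X_{1..r} => a i <= b i)%N S
                          | (x i)%:Z <= pairing m (rho i)] m <->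
               avoids idx [seq x : 'X_{1..r} <- S | (x i)%:Z <= pairing m (rho i)] m.
  by split=> av x; rewrite mem_filter => xS; apply: av;
    move: xS; rewrite mem_filter mem_sort.
by rewrite av_sort; tauto.
Qed.

Lemma Klyachko_DeltaE g idx m :
  Klyachko_Delta rho g idx m <-> Klyachko_C rho g idx m /\ avoids idx g m.
Proof.
rewrite /Klyachko_Delta Delta_revE //.
have Cr : Klyachko_C rho g (rev idx) m <-> Klyachko_C rho g idx m.
  by split=> C i hi; apply: C; move: hi; rewrite mem_rev.
rewrite Cr; split=> -[C av]; split=> // x gx; have [i idx_i lt_mx] := av x gx;
  by exists i; move: idx_i; rewrite ?mem_rev.
Qed.

(** If some exponent of chi^m on the cone is below the least exponent of the
    generators, that ray alone prevents every generator from dividing chi^m. *)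
Lemma avoids_out_C g idx m : ~ Klyachko_C rho g idx m -> avoids idx g m.
Proof.
move=> nC x gx; apply: contrapT => nav; apply: nC => i idx_i.
apply: (@le_trans _ _ (x i)%:Z); first by rewrite lez_nat min_exp_le_mem.
by rewrite leNgt; apply/negP => lt_mx; apply: nav; exists i.
Qed.

Lemma avoids_div idx S S' m :
  (forall x, x \in S -> exists2 y, y \in S' & (y <= x)%MM) ->
  avoids idx S' m -> avoids idx S m.
Proof.
move=> div av x /div[y /av[i idx_i lt_my] /mnm_lepP/(_ i) le_yx].
by exists i => //; apply: lt_le_trans lt_my _; rewrite lez_nat.
Qed.

End DeltaStaircase.

(** * Least exponents, divisibility and concatenation *)

Lemma min_exp_div_le r (S S' : seq 'X_{1..r}) (i : 'I_r) (z : int) :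
  S != [::] -> S' != [::] ->
  (forall x, x \in S -> exists2 y, y \in S' & (y <= x)%MM) ->
  (min_exp S i)%:Z <= z -> (min_exp S' i)%:Z <= z.
Proof.
move=> S0 S'0 div /min_exp_le -/(_ S0)[x /div[y Sy /mnm_lepP/(_ i) le_yx] le_xz].
by apply/min_exp_le => //; exists y => //; apply: le_trans le_xz; rewrite lez_nat.
Qed.

Lemma min_exp_cat_le r (S S' : seq 'X_{1..r}) (i : 'I_r) (z : int) :
  S != [::] -> S' != [::] -> ((min_exp (S ++ S') i)%:Z <= z) =
  (Num.min (min_exp S i)%:Z (min_exp S' i)%:Z <= z).
Proof.
move=> S0 S'0; have SS0 : S ++ S' != [::] by case: (S) S0.
rewrite ge_min; apply/idP/orP.
  move=> /min_exp_le -/(_ SS0)[x]; rewrite mem_cat => /orP[] Sx le_xz.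
    by left; apply/min_exp_le => //; exists x.
  by right; apply/min_exp_le => //; exists x.
by case=> /min_exp_le h; apply/min_exp_le => //; case: h => // x Sx le_xz;
  exists x; rewrite // mem_cat Sx ?orbT.
Qed.

(** * The Klyachko diagram of a sum *)

Theorem corollary3p6 (R : realType) (n : nat) (Sigma : set (set 'rV[R]_n))
  (hfan : is_fan Sigma) (hsmooth : smooth_fan Sigma)
  (hcomplete : complete_fan Sigma)
  (r : nat) (rho : 'I_r -> set 'rV[R]_n) (hrho : ordered_rays Sigma rho)
  (I J : set (Cox R r)) (gI gJ gK : seq 'X_{1..r})
  (hI : generated_by_monomials I gI) (hJ : generated_by_monomials J gJ)
  (hK : generated_by_monomials (ideal_add I J) gK)
  (sigma : set 'rV[R]_n) (hsigma : Sigma sigma)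
  (idx : seq 'I_r) (his : lists_rays_of rho sigma idx) :
  let CI := Klyachko_C rho gI idx in
  let CJ := Klyachko_C rho gJ idx in
  let CK := Klyachko_C rho gK idx in
  let DI := Klyachko_Delta rho gI idx in
  let DJ := Klyachko_Delta rho gJ idx in
  let DK := Klyachko_Delta rho gK idx in
  CK = [set m : latM n | forall i : 'I_r, face_of (rho i) sigma ->
          Num.min (min_exp gI i)%:Z (min_exp gJ i)%:Z <= pairing m (rho i)]
  /\
  DK = (DI `&` DJ) `|` (DI `&` (CK `\` CJ)) `|` (DJ `&` (CK `\` CI))
       `|` (CK `\` (CI `|` CJ)).
Proof.
move=> CI CJ CK DI DJ DK.
have [[gI0 IE] [gJ0 JE] [gK0 KE]] := And3 hI hJ hK.
have [div_K div_IJ] := ideal_add_gens_div IE JE KE.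
have gIJ0 : gI ++ gJ != [::] by case: (gI) gI0.
have CKE m : CK m <-> forall i, i \in idx ->
    Num.min (min_exp gI i)%:Z (min_exp gJ i)%:Z <= pairing m (rho i).
  split=> C i /C; rewrite -min_exp_cat_le //; exact: min_exp_div_le.
have CIK m : CI m -> CK m by move=> C; apply/CKE => i /C; rewrite ge_min => ->.
have CJK m : CJ m -> CK m.
  by move=> C; apply/CKE => i /C; rewrite ge_min orbC => ->.
have avK m : avoids rho idx gK m <-> avoids rho idx gI m /\ avoids rho idx gJ m.
  split=> [/(avoids_div div_IJ) av|[avI avJ]].
    by split=> x gx; apply: av; rewrite mem_cat gx ?orbT.
  by apply: (avoids_div div_K) => x; rewrite mem_cat => /orP[/avI|/avJ].
split; apply/seteqP; split=> m.
- by move=> /CKE C i /(proj2 (proj2 his i)) /C.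
- by move=> C; apply/CKE => i /(proj2 his i) /C.
- move=> /Klyachko_DeltaE[Km /avK[avI avJ]].
  have [Im|nIm] := pselect (CI m); have [Jm|nJm] := pselect (CJ m).
  + by left; left; left; split; apply/Klyachko_DeltaE.
  + by left; left; right; split; [apply/Klyachko_DeltaE | split].
  + by left; right; split; [apply/Klyachko_DeltaE | split].
  + by right; split=> // -[].
- have outI : ~ CI m -> avoids rho idx gI m by apply: avoids_out_C.
  have outJ : ~ CJ m -> avoids rho idx gJ m by apply: avoids_out_C.
  move=> dm; apply/Klyachko_DeltaE; rewrite avK.
  case: dm => [[[[/Klyachko_DeltaE[Im avI] /Klyachko_DeltaE[Jm avJ]]
               |[/Klyachko_DeltaE[Im avI] [Km /outJ avJ]]]
              |[/Klyachko_DeltaE[Jm avJ] [Km /outI avI]]]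
             |[Km nIJ]]; split=> //; first exact: CIK.
  by split; [apply: outI | apply: outJ] => ?; apply: nIJ; [left | right].
Qed.
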